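(* Let $r\ge 1$, let $a_1,\dots,a_{r+1}\in\mathbb{N}_0$ and let $c_1,\dots,c_r$ be integers with $c_j\ge 3$ for all $j$. Set $\mathbf{s}=(\{2\}^{a_1},c_1,\{2\}^{a_2},c_2,\dots,\{2\}^{a_r},c_r,\{2\}^{a_{r+1}})$. Then $$\zeta^\star(\mathbf{s})=-\sum_{\mathbf{p}}2^{\ell(\mathbf{p})}\,\zeta(\mathbf{p}),$$ where the sum runs over all $$\mathbf{p}=(\overline{2a_1+2})\circ 1^{\circ(c_1-3)}\circ(2a_2+3)\circ 1^{\circ(c_2-3)}\circ\cdots\circ(2a_r+3)\circ 1^{\circ(c_r-3)}\circ(2a_{r+1}+1)$$ obtained by replacing each occurrence of the symbol $\circ$, independently, by either the comma ''$,$'' or the operation ''$\oplus$''.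
   Context: $\mathbb{N}_0$ is the set of non-negative integers and $\mathbb{Z}^*$ is the set of nonzero integers. For $\mathbf{s}=(s_1,\dots,s_m)\in(\mathbb{Z}^* )^m$ and $n\ge 1$ put $$H_n(\mathbf{s})=\sum_{n\ge k_1>k_2>\cdots>k_m\ge 1}\ \prod_{i=1}^m\frac{\operatorname{sgn}(s_i)^{k_i}}{k_i^{|s_i|}},\qquad H_n^\star(\mathbf{s})=\sum_{n\ge k_1\ge k_2\ge\cdots\ge k_m\ge 1}\ \prod_{i=1}^m\frac{\operatorname{sgn}(s_i)^{k_i}}{k_i^{|s_i|}},$$ and $\zeta(\mathbf{s})=\lim_{n\to\infty}H_n(\mathbf{s})$, $\zeta^\star(\mathbf{s})=\lim_{n\to\infty}H^\star_n(\mathbf{s})$ (alternating Euler sums and their star version; multiple zeta values and multiple zeta star values when all entries are positive). The depth of $\mathbf{s}$ is $\ell(\mathbf{s})=m$. $\{2\}^a$ denotes the string consisting of $a$ entries equal to $2$ (empty if $a=0$). For a positive integer $m$, $\overline{m}$ denotes the negative entry $-m$. For $\alpha,\beta\in\mathbb{Z}^*$, $\alpha\oplus\beta=\operatorname{sgn}(\alpha)\operatorname{sgn}(\beta)(|\alpha|+|\beta|)$. $1^{\circ c}$ denotes $1\circ 1\circ\cdots\circ 1$ with $c$ ones; when $c=0$ this block is absent, and its two neighbours are joined by a single $\circ$. Thus in the sum each $\mathbf{p}$ is built from the list of entries $\overline{2a_1+2}$, then $c_1-3$ ones, then $2a_2+3$, then $c_2-3$ ones, ..., then $2a_r+3$,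 then $c_r-3$ ones, then $2a_{r+1}+1$, by choosing, between each pair of consecutive entries, either to keep them as separate components (comma) or to combine them by $\oplus$. When $r=1$ the list is $\overline{2a_1+2}$, then $c_1-3$ ones, then $2a_2+1$. *)

(* Defs.v *)
From HB Require Import structures.
From mathcomp Require Import all_boot all_order all_algebra.
From mathcomp Require Import all_classical all_reals all_analysis.

Set Implicit Arguments.
Unset Strict Implicit.
Unset Printing Implicit Defensive.

Import Order.TTheory GRing.Theory Num.Theory.
Import numFieldNormedType.Exports.

Local Open Scope classical_set_scope.
Local Open Scope ring_scope.

(* A string of nonzero integers is a [seq int]; its depth is its [size].
   All strings occurring in the theorem have nonzero entries. *)

Definition euler_term (R : realType) (s : seq int) (k : seq nat) : R :=
  \prod_(i < size s)
    ((sgz s`_i)%:~R ^+ nth 0%N k i / (nth 0%N k i)%:R ^+ absz s`_i).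

Definition euler_sum (R : realType) (s : seq int) (n : nat) : R :=
  \sum_(k : (size s).-tuple 'I_n.+1 |
          all (leq 1) (map val k) && sorted gtn (map val k))
    euler_term R s (map val k).

Definition euler_star_sum (R : realType) (s : seq int) (n : nat) : R :=
  \sum_(k : (size s).-tuple 'I_n.+1 |
          all (leq 1) (map val k) && sorted geq (map val k))
    euler_term R s (map val k).

Definition zeta (R : realType) (s : seq int) : R :=
  lim (euler_sum R s n @[n --> \oo]).

Definition zeta_star (R : realType) (s : seq int) : R :=
  lim (euler_star_sum R s n @[n --> \oo]).

Definition oplus (x y : int) : int :=
  sgz x * sgz y * (`|x| + `|y|).

(* The string x o y_1 o ... o y_m obtained from l = [:: y_1; ...; y_m] when the
   i-th "o" is the comma if the i-th entry of b is true, and [oplus] otherwise.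
   Only used with [size b = size l]. *)
Fixpoint circ (b : seq bool) (x : int) (l : seq int) : seq int :=
  match b, l with
  | true :: b', y :: l' => x :: circ b' y l'
  | false :: b', y :: l' => circ b' (oplus x y) l'
  | _, _ => [:: x]
  end.

(* The indices are shifted by one: a_1, ..., a_{r+1} are [a 0], ..., [a r] and
   c_1, ..., c_r are [c 0], ..., [c (r - 1)].  For j : 'I_r, the ordinals
   [widen_ord (leqnSn r) j] and [lift ord0 j] of 'I_r.+1 have values j and
   j + 1. *)

Definition star_string (r : nat) (a : 'I_r.+1 -> nat) (c : 'I_r -> nat) :
    seq int :=
  flatten [seq rcons (nseq (a (widen_ord (leqnSn r) j)) 2) (c j)%:Z
          | j <- enum 'I_r]
    ++ nseq (a ord_max) 2.

Definition first_entry (r : nat) (a : 'I_r.+1 -> nat) : int :=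
  - (2 * a ord0 + 2)%N%:Z.

Definition other_entries (r : nat) (a : 'I_r.+1 -> nat) (c : 'I_r -> nat) :
    seq int :=
  flatten [seq rcons (nseq (c j - 3) 1)
                     (2 * a (lift ord0 j) + (if j.+1 == r then 1 else 3))%N%:Z
          | j <- enum 'I_r].

(* Main.v *)
Require Import Defs.
From HB Require Import structures.
From mathcomp Require Import all_boot all_order all_algebra.
From mathcomp Require Import all_classical all_reals all_analysis.
From mathcomp Require Import ring.

(* Put w(n, k) = 'C(n, k) / 'C(n + k, k).  If f(n) = - sum_k (-1)^k w(n, k) g(k)
   for all n >= 1, then the two operations on f
     f |-> sum_(m <= n) f(m) / m^2   and   f |-> f(n) / n
   become, on the coefficients,
     g |-> g(k) / k^2   and   g |-> g(k) / k + 2 sum_(j < k) g(j) / j,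
   by telescoping in n and in k respectively.  Starting from f = 1, g = 2 and
   reading the string s from the right (an entry c is c - 2 divisions by n
   followed by one summation with 1 / m^2), this gives the finite identity
     H*_n(s) = - sum_p 2^l(p) sum_(k_1 > k_2 > ...) w(n, k_1) (...)
   whose right-hand side has the summands of the sums H_n(p).  All p start
   with an entry of absolute value at least 2, so these sums converge
   absolutely; since 0 <= w <= 1 and w(n, k) --> 1 as n grows, dominated
   convergence yields the theorem. *)

Set Implicit Arguments.
Unset Strict Implicit.
Unset Printing Implicit Defensive.

Import Order.TTheory GRing.Theory Num.Theory.
Import numFieldNormedType.Exports.

Local Open Scope classical_set_scope.
Local Open Scope ring_scope.

Section Sums.
Variable R : realType.
Implicit Types (s l : seq int) (x y : int) (n k : nat).

(** * Recursive form of the truncated sums *)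

Definition euler_factor x k : R := (sgz x)%:~R ^+ k / k%:R ^+ absz x.

Fixpoint hsum s n : R :=
  if s is x :: s' then
    \sum_(1 <= k < n.+1) euler_factor x k * hsum s' k.-1
  else 1.

Fixpoint hstar s n : R :=
  if s is x :: s' then
    \sum_(1 <= k < n.+1) euler_factor x k * hstar s' k
  else 1.

Lemma big_tuple_cons (T : finType) m (P : pred (seq T)) (F : seq T -> R) :
  \sum_(t : m.+1.-tuple T | P t) F t =
  \sum_x \sum_(t : m.-tuple T | P (x :: t)) F (x :: t).
Proof.
rewrite pair_big_dep /=.
rewrite (reindex (fun p : T * m.-tuple T => [tuple of p.1 :: p.2])) //=.
exists (fun t : m.+1.-tuple T => (thead t, [tuple of behead t])).
  by case=> x t _; congr (_, _); apply/val_inj.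
by move=> t _; rewrite -tuple_eta.
Qed.

Lemma euler_term_cons x s i (k : seq nat) :
  euler_term R (x :: s) (i :: k) = euler_factor x i * euler_term R s k.
Proof. by rewrite /euler_term big_ord_recl. Qed.

(** The cap [N] on the index type and the bound [b] on the first index are kept apart, so that the
    recursion on [s] never changes the type of the indices. *)
Definition path_sum (e : rel nat) s N b : R :=
  \sum_(k : (size s).-tuple 'I_N.+1 |
          all (leq 1) (map val k) && path e b (map val k))
    euler_term R s (map val k).

Lemma path_sum_nil e N b : path_sum e [::] N b = 1.
Proof.
rewrite /path_sum (big_pred1 [tuple]); first by rewrite /euler_term big_ord0.
by move=> t; rewrite tuple0 /= eqxx.
Qed.

Lemma path_sum_cons e x s N b :
  path_sum e (x :: s) N b =
  \sum_(i < N.+1 | (1 <= i)%N && e b i)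
    euler_factor x i * path_sum e s N i.
Proof.
rewrite /path_sum (@big_tuple_cons _ (size s) (fun k : seq 'I_N.+1 =>
   all (leq 1) (map val k) && path e b (map val k))
  (fun k : seq _ => euler_term R (x :: s) (map val k))) [RHS]big_mkcond /=.
apply: eq_bigr => i _; case: ifP => [/andP[i1 ebi]|/negbT].
  rewrite mulr_sumr; apply: eq_big => [t|t _]; first by rewrite i1 ebi.
  by rewrite euler_term_cons.
move=> nie; rewrite big_pred0 // => t; apply: contraNF nie.
by case/andP => /andP[-> _] /andP[-> _].
Qed.

Lemma path_sum_gtn s N n : (n <= N)%N -> path_sum gtn s N n.+1 = hsum s n.
Proof.
elim: s n => [|x s IH] n nN; first by rewrite path_sum_nil.
rewrite path_sum_cons /= big_geq_mkord.
rewrite (big_ord_widen_cond N.+1 (leq 1)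
  (fun i => euler_factor x i * hsum s i.-1)) //.
apply: eq_bigr => i /andP[i1 iN]; congr (_ * _).
by rewrite -{1}(prednK i1) IH // -ltnS prednK // ltnW // ltnS.
Qed.

Lemma path_sum_geq s N n : (n <= N)%N -> path_sum geq s N n = hstar s n.
Proof.
elim: s n => [|x s IH] n nN; first by rewrite path_sum_nil.
rewrite path_sum_cons /= big_geq_mkord.
rewrite (big_ord_widen_cond N.+1 (leq 1)
  (fun i => euler_factor x i * hstar s i)) //.
apply: eq_bigr => i /andP[i1 iN]; congr (_ * _).
by rewrite IH // -ltnS.
Qed.

Lemma euler_sumE s n : euler_sum R s n = hsum s n.
Proof.
rewrite -(path_sum_gtn s (leqnn n)); apply: eq_bigl => -[[|i k] ?] //=.
by rewrite ltn_ord.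
Qed.

Lemma euler_star_sumE s n : euler_star_sum R s n = hstar s n.
Proof.
rewrite -(path_sum_geq s (leqnn n)); apply: eq_bigl => -[[|i k] ?] //=.
by have -> : (i <= n)%N by rewrite -ltnS.
Qed.

(** * The weights: recurrences, bounds and limit *)

(* This is 'C(n, k) / 'C(n + k, k). *)
Definition weight n k : R := \prod_(j < k) ((n%:R - j%:R) / (n + j).+1%:R).

Lemma weight0 n : weight n 0 = 1.
Proof. exact: big_ord0. Qed.

Lemma weightS n k :
  weight n k.+1 = weight n k * ((n%:R - k%:R) / (n + k).+1%:R).
Proof. exact: big_ord_recr. Qed.

Lemma weight_small n k : (n < k)%N -> weight n k = 0.
Proof.
by move=> nk; rewrite /weight (bigD1 (Ordinal nk)) //= subrr !mul0r.
Qed.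

(** Recurrence in [k], cleared of denominators; it drives the telescoping in [k]. *)
Lemma weight_recl n k :
  weight n k.+1 * (n%:R + k%:R + 1) = weight n k * (n%:R - k%:R).
Proof.
by rewrite weightS -natrD natr1 -mulrA divfK // pnatr_eq0.
Qed.

(** Recurrence in [n]: for [k >= 1] it reads [w(n+1, k) / (n+1)^2 = (w(n+1, k) - w(n, k)) / k^2], a
    difference in [n]. *)
Lemma weight_succ n k :
  weight n k * n.+1%:R ^+ 2 = weight n.+1 k * (n.+1%:R ^+ 2 - k%:R ^+ 2).
Proof.
elim: k => [|k IH]; first by rewrite !weight0 expr0n subr0.
have n0 : 1 + n%:R != 0 :> R by rewrite nat1r pnatr_eq0.
have a0 : 1 + (n%:R + k%:R) != 0 :> R by rewrite -natrD nat1r pnatr_eq0.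
have b0 : 1 + (1 + (n%:R + k%:R)) != 0 :> R.
  by rewrite -natrD !nat1r pnatr_eq0.
have -> : weight n k.+1 * n.+1%:R ^+ 2 =
  (weight n k * n.+1%:R ^+ 2) * ((n%:R - k%:R) / (n + k).+1%:R).
  by rewrite weightS; ring.
rewrite IH weightS addSn -!(nat1r (n + k).+1) -!(nat1r (n + k)) natrD.
by rewrite -(nat1r n) -(nat1r k); field; rewrite a0 b0.
Qed.

Lemma weight_ge0 n k : 0 <= weight n k.
Proof.
have [nk|kn] := ltnP n k; first by rewrite weight_small.
apply: prodr_ge0 => j _; rewrite divr_ge0 // subr_ge0 ler_nat.
exact: leq_trans (ltnW _) kn.
Qed.

Lemma weight_le1 n k : weight n k <= 1.
Proof.
have [nk|kn] := ltnP n k; first by rewrite weight_small.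
apply: prodr_ile1 => j _.
have jn : (j <= n)%N by apply: leq_trans (ltnW _) kn.
rewrite divr_ge0 ?subr_ge0 ?ler_nat //= ler_pdivrMr ?ltr0n // mul1r.
by rewrite -addnS natrD lerD2l (le_trans (y := 0)) ?oppr_le0.
Qed.

Lemma cvg_weight k : weight n k @[n --> \oo] --> (1 : R).
Proof.
elim: k => [|k IH].
  by under eq_fun do rewrite weight0; apply: cvg_cst.
under eq_fun do rewrite weightS.
suff H : (n%:R - k%:R) / (n + k).+1%:R @[n --> \oo] --> (1 : R).
  by have := cvgM IH H; rewrite mulr1; apply.
have E n : (n%:R - k%:R) / (n + k).+1%:R =
           1 - (k + k).+1%:R * (n + k).+1%:R^-1 :> R.
  have a0 : (n + k).+1%:R != 0 :> R by rewrite pnatr_eq0.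
  apply: (mulIf a0); rewrite divfK // mulrBl mulfVK // mul1r.
  by rewrite -!natr1 !natrD; ring.
under eq_fun do rewrite E.
have H : (n + k).+1%:R^-1 @[n --> \oo] --> (0 : R).
  by have := @cvg_harmonic R; rewrite -(cvg_shiftn k).
have := cvgB (cvg_cst (1 : R)) (cvgM (cvg_cst ((k + k).+1%:R : R)) H).
by rewrite mulr0 subr0; apply.
Qed.

(** * Alternating weighted representations and the operations on them *)

(** [n = 0] is excluded because the right-hand side is then an empty sum, whereas the starting
    function is 1 there. *)
Definition represents (g f : nat -> R) :=
  forall n, (0 < n)%N ->
  f n = - \sum_(1 <= k < n.+1) (-1) ^+ k * weight n k * g k.

Lemma represents_one : represents (fun=> 2) (fun=> 1).
Proof.
move=> n n0.
(* The partial sums have a closed form, by the recurrence in [k] and [2 n = (n - k) + (n + k)]; it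
   vanishes at [N = n]. *)
have H N : n%:R * \sum_(1 <= k < N.+1) (-1) ^+ k * weight n k * 2 + n%:R =
   (-1) ^+ N * weight n N * (n%:R - N%:R).
  elim: N => [|N IH]; first by rewrite big_geq // weight0; ring.
  rewrite big_nat_recr //= mulrDr addrAC IH -mulrA -weight_recl exprS.
  by rewrite -(nat1r N); ring.
have := H n; rewrite subrr mulr0 -[X in _ + X]mulr1 -mulrDr => /eqP.
by rewrite mulf_eq0 pnatr_eq0 eqn0Ngt n0 /= addrC addr_eq0 => /eqP.
Qed.

Lemma represents_sum_sqr g f : represents g f ->
  represents (fun k => g k / k%:R ^+ 2)
    (fun n => \sum_(1 <= m < n.+1) f m / m%:R ^+ 2).
Proof.
move=> H n _; elim: n => [|n IH]; first by rewrite !big_geq ?oppr0.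
rewrite big_nat_recr //= IH H //.
(* The ranges can be aligned since [w(n, n+1) = 0]; then the recurrence in [n] compares the sums
   term by term. *)
have -> : \sum_(1 <= k < n.+1) (-1) ^+ k * weight n k * (g k / k%:R ^+ 2) =
    \sum_(1 <= k < n.+2) (-1) ^+ k * weight n k * (g k / k%:R ^+ 2).
  by rewrite [RHS]big_nat_recr //= weight_small // mulr0 mul0r addr0.
rewrite mulNr -opprD; congr (- _); rewrite mulr_suml -big_split /=.
apply: eq_big_nat => k /andP[k1 _].
have k0 : k%:R != 0 :> R by rewrite pnatr_eq0 -lt0n.
have n0 : n.+1%:R != 0 :> R by rewrite pnatr_eq0.
have := weight_succ n k => /(canRL (mulfK (expf_neq0 2 n0))) ->.
by move: n.+1%:R n0 => m m0; field; rewrite k0.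
Qed.

(* On the coefficient side, dividing [f n] by [n] is prepending "1 o" to the
   string: the first summand is the choice of (+), the second the comma. *)
Definition fold_one (g : nat -> R) k : R :=
  g k / k%:R + 2 * \sum_(1 <= j < k) g j / j%:R.

(** Summation by parts: with [T] the partial sums of [g j / j], the new coefficient is
    [T (k-1) + T k], while [g k = k (T k - T (k-1))]. Hence [n] times the new sum minus the old one
    telescopes to a boundary term, which vanishes at [N = n]. *)
Lemma represents_div g f : represents g f ->
  represents (fold_one g) (fun n => f n / n%:R).
Proof.
move=> H n n0; rewrite (H n n0).
have nn0 : n%:R != 0 :> R by rewrite pnatr_eq0 -lt0n.
pose T k := \sum_(1 <= j < k.+1) g j / j%:R.
have TS k : T k.+1 = T k + g k.+1 / k.+1%:R by rewrite /T big_nat_recr.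
have E k : fold_one g k.+1 = T k + T k.+1 by rewrite TS /fold_one -/(T k); ring.
have P N : n%:R * \sum_(1 <= k < N.+1) (-1) ^+ k * weight n k * fold_one g k -
   \sum_(1 <= k < N.+1) (-1) ^+ k * weight n k * g k =
   (-1) ^+ N * T N * (weight n N * (n%:R - N%:R)).
  elim: N => [|N IH].
    by rewrite !big_geq // /T big_geq // !mulr0 subrr mul0r.
  have g1 : g N.+1 = N.+1%:R * (T N.+1 - T N).
    by rewrite TS addrC addKr mulrC divfK // pnatr_eq0.
  rewrite 2?[\sum_(1 <= k < N.+2) _]big_nat_recr //= mulrDr opprD addrACA IH.
  rewrite -weight_recl g1 E exprS.
  by rewrite -(nat1r N); ring.
have := P n; rewrite subrr !mulr0 => /eqP; rewrite subr_eq0 => /eqP <-.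
by rewrite mulNr mulrC mulKf.
Qed.

Lemma represents_iter g f d : represents g f ->
  represents (iter d fold_one g) (fun n => f n / n%:R ^+ d).
Proof.
move=> H; elim: d => [|d IH].
  have -> // : (fun n => f n / n%:R ^+ 0) = f.
  by apply/funext => n; rewrite divr1.
have -> : (fun n => f n / n%:R ^+ d.+1) = (fun n => f n / n%:R ^+ d / n%:R).
  by apply/funext => n; rewrite -mulrA -invfM -exprSr.
exact: represents_div.
Qed.

Lemma euler_factor_pos c k : (0 < c)%N -> euler_factor c%:Z k = (k%:R ^+ c)^-1.
Proof. by move=> c0; rewrite /euler_factor gtr0_sgz // expr1n mul1r. Qed.

Lemma represents_nseq2 g s m : represents g (hstar s) ->
  represents (fun k => g k / k%:R ^+ (2 * m)) (hstar (nseq m 2 ++ s)).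
Proof.
move=> H; elim: m => [|m IH].
  have -> // : (fun k => g k / k%:R ^+ (2 * 0)) = g.
  by apply/funext => k; rewrite muln0 divr1.
have -> : (fun k => g k / k%:R ^+ (2 * m.+1)) =
          (fun k => g k / k%:R ^+ (2 * m) / k%:R ^+ 2).
  by apply/funext => k; rewrite -mulrA -invfM -exprD mulnS addnC.
have -> : hstar (nseq m.+1 2 ++ s) =
   (fun n => \sum_(1 <= j < n.+1) hstar (nseq m 2 ++ s) j / j%:R ^+ 2).
  apply/funext => n; apply: eq_bigr => j _.
  by rewrite (euler_factor_pos (c := 2)) // mulrC.
exact: represents_sum_sqr.
Qed.

Lemma represents_cons g s c : (2 <= c)%N -> represents g (hstar s) ->
  represents (fun k => iter (c - 2) fold_one g k / k%:R ^+ 2)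
    (hstar (c%:Z :: s)).
Proof.
move=> c2 H.
have -> : hstar (c%:Z :: s) =
   (fun n => \sum_(1 <= j < n.+1) hstar s j / j%:R ^+ (c - 2) / j%:R ^+ 2).
  apply/funext => n; apply: eq_bigr => j _.
  rewrite euler_factor_pos; last exact: leq_trans c2.
  by rewrite -mulrA -invfM -exprD subnK // mulrC.
by apply: represents_sum_sqr; apply: represents_iter.
Qed.

(** * Coefficients representing the whole star string *)

Lemma star_stringS r (a : 'I_r.+2 -> nat) (c : 'I_r.+1 -> nat) :
  star_string a c = nseq (a ord0) 2 ++ (c ord0)%:Z ::
    star_string (a \o lift ord0) (c \o lift ord0).
Proof.
rewrite /star_string enum_ordSl /= -cats1 -!catA -map_comp /=.
congr (nseq (a _) _ ++ _ :: flatten _ ++ nseq (a _) _); try exact: val_inj.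
by apply: eq_map => j /=; congr (rcons (nseq (a _) _) _); apply: val_inj.
Qed.

Lemma other_entriesS r (a : 'I_r.+2 -> nat) (c : 'I_r.+1 -> nat) :
  other_entries a c = nseq (c ord0 - 3) 1 ++
    (2 * a (lift ord0 ord0) + (if r == 0 then 1 else 3))%N%:Z ::
    other_entries (a \o lift ord0) (c \o lift ord0).
Proof.
rewrite /other_entries enum_ordSl /= -cats1 -catA -map_comp /=.
by rewrite eqSS eq_sym.
Qed.

(** The exponent is lowered by one because [fold_one] itself divides by the index. Its two summands
    are the two choices for the symbol in front of [y]; the final 2 counts the last component. *)
Definition circ_coef (l : seq int) : nat -> R :=
  foldr (fun y d => fold_one (fun k => d k / k%:R ^+ (absz y).-1)) (fun=> 2) l.

Lemma circ_coef_nseq1 m l :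
  circ_coef (nseq m 1 ++ l) = iter m fold_one (circ_coef l).
Proof.
elim: m => //= m ->; congr fold_one.
by apply/funext => k; rewrite divr1.
Qed.

(** Induction on [r], peeling off the first block. The case [r = 0] serves as base; the exponents
    [2a] and [2a + 2] are one less than the entries [2a + 1] and [2a + 3] that arise once a further
    block is put in front. *)
Lemma represents_star_string r (a : 'I_r.+1 -> nat) (c : 'I_r -> nat) :
  (forall j, 3 <= c j)%N ->
  represents (fun k => circ_coef (other_entries a c) k /
                       k%:R ^+ (2 * a ord0 + (if r == 0 then 0 else 2))%N)
    (hstar (star_string a c)).
Proof.
elim: r => [|r IH] in a c *.
  move=> _; rewrite /star_string /other_entries enum_ord0 /= addn0.
  rewrite -[nseq _ _]cats0 (_ : ord_max = ord0); last exact: val_inj.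
  exact: (@represents_nseq2 (fun=> 2) [::] _ represents_one).
move=> c3.
have H := IH (a \o lift ord0) (c \o lift ord0) (fun j => c3 (lift ord0 j)).
have := @represents_nseq2 _ _ (a ord0) (represents_cons (ltnW (c3 ord0)) H).
rewrite -star_stringS; congr represents; apply/funext => k /=.
rewrite -mulrA -invfM -exprD other_entriesS circ_coef_nseq1.
(* The innermost [fold_one] belongs to the entry [2a + 1] or [2a + 3], the other [c - 3] to the ones
   before it. *)
rewrite (_ : c ord0 - 2 = (c ord0 - 3).+1)%N; last by rewrite -subSn.
rewrite iterSr.
congr (iter _ fold_one (fold_one _) _ / _ ^+ _); last exact: addnC.
apply/funext => j.
by congr (_ / _ ^+ _); case: ifP; rewrite ?addn0 ?addn1 ?addn2 ?addn3.
Qed.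

(** * Expansion of the coefficients over all strings p *)

(** The part of the sum for [p] with largest index [k], isolated because the weight depends on that
    index only. *)
Definition lead_term (p : seq int) k : R :=
  euler_factor (head 0 p) k * hsum (behead p) k.-1.

Lemma circ_nonempty b x l :
  circ b x l = head 0 (circ b x l) :: behead (circ b x l).
Proof. by elim: b x l => [|[] b IH] x [|y l] /=. Qed.

Lemma hsum_circ b x l n :
  hsum (circ b x l) n = \sum_(1 <= k < n.+1) lead_term (circ b x l) k.
Proof. by rewrite circ_nonempty. Qed.

Lemma euler_factor_oplus x y k : 0 < y ->
  x != 0 -> euler_factor (oplus x y) k = euler_factor x k / k%:R ^+ absz y.
Proof.
move=> y0 x0; rewrite /euler_factor.
have xy0 : 0 < `|x| + `|y| by rewrite addr_gt0 ?normr_gt0 // gt_eqF.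
have -> : sgz (oplus x y) = sgz x.
  by rewrite /oplus (gtr0_sgz y0) mulr1 sgzM sgz_id (gtr0_sgz xy0) mulr1.
have -> : absz (oplus x y) = (absz x + absz y)%N.
  by rewrite /oplus !abszM -!sgrz !absz_sg x0 (gt_eqF y0) !mul1n.
by rewrite exprD invfM mulrA.
Qed.

Lemma oplus_neq0 x y : 0 < y -> x != 0 -> oplus x y != 0.
Proof.
move=> y0 x0; rewrite /oplus !mulf_neq0 ?sgz_eq0 ?(gt_eqF y0) //.
by rewrite gt_eqF // addr_gt0 ?normr_gt0 // gt_eqF.
Qed.

(** Induction on [l], splitting on the first choice: [oplus] divides the leading factor by a power
    of [k], and the comma contributes a factor 2 and an inner sum over [j < k] led by [y]. *)
Lemma sum_lead_term_circ x l k : (0 < k)%N -> x != 0 ->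
  all (fun y => 0 < y) l ->
  \sum_(b : (size l).-tuple bool)
     2 ^+ size (circ b x l) * lead_term (circ b x l) k =
  euler_factor x k * circ_coef l k.
Proof.
elim: l x k => [|y l IH] x k k0 x0 /=.
  rewrite (big_pred1 [tuple]) => [_|b]; last by rewrite [b]tuple0 /= eqxx.
  by rewrite /lead_term /= mulr1 expr1 mulrC.
case/andP => y0 l0.
have yn0 : y != 0 by rewrite gt_eqF.
rewrite (@big_tuple_cons _ (size l) xpredT (fun b : seq bool =>
  2 ^+ size (circ b x (y :: l)) * lead_term (circ b x (y :: l)) k)).
rewrite big_bool /= IH ?oplus_neq0 // euler_factor_oplus //.
have -> : \sum_(t : (size l).-tuple bool)
   2 ^+ (size (circ t y l)).+1 * lead_term (x :: circ t y l) k =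
   euler_factor x k * (2 * \sum_(1 <= j < k) circ_coef l j / j%:R ^+ absz y).
  transitivity (\sum_(t : (size l).-tuple bool) \sum_(1 <= j < k)
     euler_factor x k * 2 *
       (2 ^+ size (circ t y l) * lead_term (circ t y l) j)).
    apply: eq_bigr => t _; rewrite /lead_term /= hsum_circ (prednK k0).
    by rewrite -mulr_sumr -mulr_sumr exprS; ring.
  rewrite exchange_big mulrA mulr_sumr; apply: eq_big_nat => j /andP[j0 _].
  rewrite -mulr_sumr IH // -(gez0_abs (ltW y0)) euler_factor_pos ?absz_gt0 //.
  by rewrite absz_nat [_^-1 * _]mulrC.
rewrite /fold_one.
have E j : circ_coef l j / j%:R ^+ (absz y).-1 / j%:R =
   circ_coef l j / j%:R ^+ absz y.
  by rewrite -mulrA -invfM -exprSr prednK ?absz_gt0.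
by under [in RHS]eq_bigr do rewrite E; rewrite E; ring.
Qed.

Lemma other_entries_gt0 r (a : 'I_r.+1 -> nat) (c : 'I_r -> nat) :
  all (fun y => 0 < y) (other_entries a c).
Proof.
elim: r => [|r IH] in a c *; first by rewrite /other_entries enum_ord0.
rewrite other_entriesS all_cat all_nseq orbT /= IH andbT.
by case: ifP => _; rewrite ltz_nat addn_gt0 orbT.
Qed.

(** The sign [(-1) ^+ k] of the representation and the exponent [2 a_1 + 2] together form the factor
    of the negative first entry. *)
Lemma hstar_star_string r (a : 'I_r.+1 -> nat) (c : 'I_r -> nat) n :
  (0 < r)%N -> (forall j, 3 <= c j)%N -> (0 < n)%N ->
  hstar (star_string a c) n =
  - \sum_(b : (size (other_entries a c)).-tuple bool)
      2 ^+ size (circ b (first_entry a) (other_entries a c)) *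
      \sum_(1 <= k < n.+1)
         weight n k * lead_term (circ b (first_entry a) (other_entries a c)) k.
Proof.
move=> r0 c3 n0; rewrite (represents_star_string a c3 n0) [r == 0]eqn0Ngt r0 /=.
under [in RHS]eq_bigr do rewrite mulr_sumr.
rewrite exchange_big; congr (- _); apply: eq_big_nat => k /andP[k0 _].
under [in RHS]eq_bigr do rewrite mulrCA.
rewrite -mulr_sumr sum_lead_term_circ ?other_entries_gt0 //; last first.
  by rewrite /first_entry addn2 oppr_eq0.
have -> : euler_factor (first_entry a) k = (-1) ^+ k / k%:R ^+ (2 * a ord0 + 2).
  by rewrite /euler_factor /first_entry abszN sgzN addn2.
by ring.
Qed.

(** * Absolute convergence *)

(** The tail of the series of [1 / k^2] from [j] on is at most [2 / j], so an inner summation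
    against [1 / j] costs only a factor 2. *)
Lemma cumulative_sum_sqr (a : nat -> R) n : (forall k, 0 <= a k) ->
  \sum_(1 <= k < n.+1) (\sum_(1 <= j < k.+1) a j / j%:R) / k%:R ^+ 2 <=
  2 * \sum_(1 <= k < n.+1) a k / k%:R ^+ 2.
Proof.
move=> a0; pose A k := \sum_(1 <= j < k.+1) a j / j%:R.
have A0 k : 0 <= A k by apply: sumr_ge0 => j _; rewrite divr_ge0.
(* The extra term [A n / n] makes the induction go through, because
   1 / (n + 1) ^ 2 + 1 / (n + 1) <= 1 / n. *)
suff H : \sum_(1 <= k < n.+1) A k / k%:R ^+ 2 + A n / n%:R <=
         2 * \sum_(1 <= k < n.+1) a k / k%:R ^+ 2.
  by apply: le_trans H; rewrite lerDl divr_ge0.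
elim: n => [|n IH].
  by rewrite !big_geq // /A big_geq // mul0r mulr0 addr0.
rewrite big_nat_recr // [X in _ <= 2 * X]big_nat_recr //= mulrDr.
apply: le_trans (lerD IH (lexx _)); rewrite -!addrA lerD2l.
have -> : A n.+1 = A n + a n.+1 / n.+1%:R by rewrite /A big_nat_recr.
have n1 : 1 <= n.+1%:R :> R by rewrite ler1n.
have h1 : a n.+1 / n.+1%:R / n.+1%:R ^+ 2 <= a n.+1 / n.+1%:R ^+ 2.
  by rewrite ler_wpM2r ?invr_ge0 ?exprn_ge0 // ler_pdivrMr ?ltr0n // ler_peMr.
have h2 : A n / n.+1%:R ^+ 2 + A n / n.+1%:R <= A n / n%:R.
  (* At [n = 0] the inverse of [n] is 0 by convention; this case rests on [A 0 = 0]. *)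
  case: (posnP n) => [->|n0]; first by rewrite /A big_geq // !mul0r addr0.
  rewrite -mulrDr ler_wpM2l // -subr_ge0.
  have p0 : 0 < n%:R :> R by rewrite ltr0n.
  have -> : n%:R^-1 - (n.+1%:R ^- 2 + n.+1%:R^-1) =
            (n%:R * n.+1%:R ^+ 2)^-1 :> R.
    rewrite -(nat1r n); field.
    by rewrite nat1r !pnatr_eq0 -!lt0n.
  by rewrite invr_ge0 mulr_ge0 // exprn_ge0.
have h3 : a n.+1 / n.+1%:R / n.+1%:R = a n.+1 / n.+1%:R ^+ 2.
  by rewrite -mulrA -invfM.
by rewrite !mulrDl h3 addrACA !mul1r lerD // lerD2r.
Qed.

Lemma normr_euler_factor_le x m k : (0 < k)%N -> (m <= absz x)%N ->
  `|euler_factor x k| <= (k%:R ^+ m)^-1.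
Proof.
move=> k0 mx; rewrite normrM normfV !normrX normr_nat -[leRHS]mul1r.
apply: ler_pM; rewrite ?invr_ge0 ?exprn_ge0 //.
  apply: exprn_ile1 => //; rewrite -intr_norm normr_sgz.
  by case: (x != 0).
rewrite lef_pV2 ?posrE ?exprn_gt0 ?ltr0n // -!natrX ler_nat.
exact: leq_pexp2l.
Qed.

(** Each entry is bounded by [1 / j] and absorbed by [cumulative_sum_sqr], doubling the constant. *)
Lemma hsum_sum_sqr_bounded s :
  all (fun x => x != 0) s ->
  exists C : R, forall n, \sum_(1 <= k < n.+1) `|hsum s k.-1| / k%:R ^+ 2 <= C.
Proof.
elim: s => [_|x s IH /andP[x0 /IH[C HC]]].
  (* The partial sums of [d j / j] are all 1. *)
  exists 2 => n; pose d (j : nat) : R := (j == 1)%:R.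
  have d1 (F : nat -> R) k : (0 < k)%N ->
      \sum_(1 <= j < k.+1) d j / F j = (F 1)^-1.
    move=> k0; rewrite big_ltn // /d eqxx mul1r big1_seq ?addr0 //= => j.
    by rewrite mem_index_iota => /andP[j1 _]; rewrite gtn_eqF ?mul0r.
  case: n => [|n]; first by rewrite big_geq.
  have := @cumulative_sum_sqr d n.+1 (fun k => ler0n _ _).
  rewrite (d1 (fun j => j%:R ^+ 2)) // expr1n invr1 mulr1; apply: le_trans.
  rewrite le_eqVlt; apply/orP; left; apply/eqP.
  apply: eq_big_nat => k /andP[k0 _].
  by rewrite (d1 (fun j => j%:R)) // invr1 normr1.
exists (2 * C) => n; apply: (le_trans _ (ler_wpM2l _ (HC n))) => //.
apply: le_trans (cumulative_sum_sqr _ _) => [|k]; last exact: normr_ge0.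
apply: ler_sum_nat => k /andP[k0 _]; rewrite ler_wpM2r ?invr_ge0 ?exprn_ge0 //=.
(* The cumulative sum runs one term further than [hsum] at [k.-1]; the extra term is nonnegative. *)
rewrite (prednK k0) big_nat_recr //=; apply: (le_trans (ler_norm_sum _ _ _)).
rewrite -[leLHS]addr0; apply: lerD; last by rewrite divr_ge0.
apply: ler_sum_nat => j /andP[j0 _]; rewrite normrM mulrC ler_wpM2l //.
by rewrite -[j%:R]expr1; apply: normr_euler_factor_le; rewrite ?absz_gt0.
Qed.

Lemma lead_term_sum_bounded (p : seq int) :
  (2 <= absz (head 0%R p))%N -> all (fun x => x != 0) (behead p) ->
  exists C : R, forall n, \sum_(1 <= k < n.+1) `|lead_term p k| <= C.
Proof.
move=> p2 /hsum_sum_sqr_bounded[C HC]; exists C => n; apply: le_trans (HC n).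
apply: ler_sum_nat => k /andP[k0 _]; rewrite normrM mulrC ler_wpM2l //.
exact: normr_euler_factor_le.
Qed.

(** * Passage to the limit *)

Lemma cvg_sum_of_bounded (t : nat -> R) (C : R) :
  (forall n, \sum_(1 <= k < n.+1) `|t k| <= C) ->
  cvg (\sum_(1 <= k < n.+1) `|t k| @[n --> \oo]) /\
  cvg (\sum_(1 <= k < n.+1) t k @[n --> \oo]).
Proof.
move=> HC.
have cN : cvg (\sum_(1 <= k < n.+1) `|t k| @[n --> \oo]).
  apply: nondecreasing_is_cvgn; last by exists C => _ [n _ <-].
  by apply/nondecreasing_seqP => n; rewrite [leRHS]big_nat_recr //= lerDl.
split=> //.
have -> : (fun n => \sum_(1 <= k < n.+1) t k) = series (fun k => t k.+1).
  by apply/funext => n; rewrite big_add1.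
apply: normed_cvg.
have <- // : (fun n => \sum_(1 <= k < n.+1) `|t k|) =
             [normed series (fun k => t k.+1)].
by apply/funext => n; rewrite big_add1.
Qed.

Lemma cvg_sumr (I : Type) (s : seq I) (f : I -> nat -> R) (l : I -> R) :
  (forall i, f i n @[n --> \oo] --> l i) ->
  \sum_(i <- s) f i n @[n --> \oo] --> \sum_(i <- s) l i.
Proof.
by move=> H; apply: cvg_big => [|i _]; [exact: add_continuous|exact: H].
Qed.

(** Dominated convergence for series: the error is at most the sum of [(1 - w(n, k)) |t k|], which
    is cut at an [M] independent of [n]. *)
Lemma cvg_weight_sum (t : nat -> R) (C : R) :
  (forall n, \sum_(1 <= k < n.+1) `|t k| <= C) ->
  \sum_(1 <= k < n.+1) weight n k * t k @[n --> \oo] -->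
  lim (\sum_(1 <= k < n.+1) t k @[n --> \oo]).
Proof.
move=> /cvg_sum_of_bounded[cN cS].
pose N n : R := \sum_(1 <= k < n.+1) `|t k|.
suff H : \sum_(1 <= k < n.+1) weight n k * t k -
         \sum_(1 <= k < n.+1) t k @[n --> \oo] --> (0 : R).
  have := cvgD H cS; rewrite add0r.
  by under [X in X @ _ --> _]eq_fun do rewrite subrK; apply.
apply/cvgr0Pnorm_lt => e e0.
have e2 : 0 < e / 2 by rewrite divr_gt0.
have [M _ HM] : \forall n \near \oo, `|lim (N n @[n --> \oo]) - N n| < e / 2.
  by have /cvgrPdist_lt := cN; apply.
have D : \sum_(1 <= k < M.+1) (1 - weight n k) * `|t k| @[n --> \oo] -->
    (0 : R).
  suff H : \sum_(1 <= k < M.+1) (1 - weight n k) * `|t k| @[n --> \oo] -->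
      \sum_(1 <= k < M.+1) (1 - 1) * `|t k|.
    by move: H; rewrite [X in _ --> X -> _]big1 // => k _; rewrite subrr mul0r.
  apply: cvg_sumr => k; apply: cvgM (cvg_cst _).
  exact: cvgB (cvg_cst _) (cvg_weight k).
have ND n m : (n <= m)%N -> N m = N n + \sum_(n.+1 <= k < m.+1) `|t k|.
  by move=> nm; rewrite /N (@big_cat_nat _ _ _ n.+1).
have Nlim n : N n <= lim (N n @[n --> \oo]).
  apply: nondecreasing_cvgn_le => // i j ij.
  by rewrite (ND i j) // lerDl sumr_ge0.
near=> n.
have Mn : (M <= n)%N by near: n; exact: nbhs_infty_ge.
rewrite -sumrB; apply: (le_lt_trans (ler_norm_sum _ _ _)).
have h k : `|weight n k * t k - t k| = (1 - weight n k) * `|t k|.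
  rewrite -[X in _ - X]mul1r -mulrBl normrM distrC.
  by rewrite (ger0_norm (x := 1 - _)) // subr_ge0 weight_le1.
under eq_bigr do rewrite h.
(* Up to [M] finitely many terms tend to 0; beyond [M] the bound [1 - w <= 1] leaves a tail of the
   absolute series. *)
rewrite (@big_cat_nat _ _ _ M.+1) //= [e]splitr; apply: ltrD.
  by near: n; apply: cvgr_lt D _ e2.
have := HM M (leqnn M); apply: le_lt_trans.
rewrite ger0_norm ?subr_ge0 // lerBrDl (le_trans _ (Nlim n)) // (ND _ _ Mn).
rewrite lerD2l; apply: ler_sum_nat => k _.
by rewrite ler_piMl // gerBl weight_ge0.
Unshelve. all: by end_near. Qed.

(** Combining with a positive entry only increases the absolute value, so every p keeps a leading
    entry large enough for absolute convergence. *)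
Lemma circ_head_ge2 b x l : all (fun y => 0 < y) l -> (2 <= absz x)%N ->
  (2 <= absz (head 0%R (circ b x l)))%N.
Proof.
elim: l b x => [|y l IH] [|[] b] x //= /andP[y0 l0] x2; apply: IH => //.
have xn0 : x != 0 by rewrite -absz_gt0 (leq_trans _ x2).
rewrite /oplus !abszM -!sgrz !absz_sg xn0 (gt_eqF y0) !mul1n.
exact: leq_trans x2 (leq_addr _ _).
Qed.

Lemma circ_neq0 b x l : all (fun y => 0 < y) l -> x != 0 ->
  all (fun y => y != 0) (circ b x l).
Proof.
elim: l b x => [|y l IH] [|[] b] x /=; rewrite ?andbT //.
  by case/andP => y0 l0 ->; rewrite IH // gt_eqF.
by case/andP => y0 l0 x0; rewrite IH // oplus_neq0.
Qed.

End Sums.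

Theorem theorem1p2 (R : realType) (r : nat) (r_ge1 : (1 <= r)%N)
    (a : 'I_r.+1 -> nat) (c : 'I_r -> nat) (c_ge3 : forall j, (3 <= c j)%N) :
  let s := star_string a c in
  let p (b : (size (other_entries a c)).-tuple bool) :=
    circ b (first_entry a) (other_entries a c) in
  [/\ cvg (euler_star_sum R s n @[n --> \oo]),
      forall b, cvg (euler_sum R (p b) n @[n --> \oo]) &
      zeta_star R s = - \sum_b 2 ^+ size (p b) * zeta R (p b)].
Proof.
move=> s p.
have p_bounded b : exists C : R, forall n,
    \sum_(1 <= k < n.+1) `|lead_term R (p b) k| <= C.
  have f2 : (2 <= absz (first_entry a))%N by rewrite abszN leq_addl.
  apply: lead_term_sum_bounded.
    exact: circ_head_ge2 (other_entries_gt0 a c) f2.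
  have := @circ_neq0 b (first_entry a) _ (other_entries_gt0 a c).
  rewrite [circ _ _ _]circ_nonempty /=.
  by case/(_ _)/andP => //; rewrite -absz_gt0 ltnW.
have sumE b : (fun n => euler_sum R (p b) n) =
    (fun n => \sum_(1 <= k < n.+1) lead_term R (p b) k).
  by apply/funext => n; rewrite euler_sumE hsum_circ.
have star_cvg : euler_star_sum R s n @[n --> \oo] -->
    - \sum_b 2 ^+ size (p b) * zeta R (p b).
  apply: (@cvg_trans _ (- (\sum_b 2 ^+ size (p b) *
      \sum_(1 <= k < n.+1) weight R n k * lead_term R (p b) k) @[n --> \oo])).
    (* The finite identity is available for [n >= 1] only, hence eventual equality. *)
    apply: near_eq_cvg; near=> n; rewrite euler_star_sumE hstar_star_string //.
    by near: n; exact: nbhs_infty_gt.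
  apply: cvgN; apply: (cvg_sumr (f := fun b n => 2 ^+ size (p b) *
      \sum_(1 <= k < n.+1) weight R n k * lead_term R (p b) k)) => b.
  apply: cvgM; first exact: cvg_cst.
  have [C HC] := p_bounded b.
  by rewrite /zeta sumE; apply: cvg_weight_sum HC.
split; [exact: cvgP star_cvg | | exact: cvg_lim star_cvg].
move=> b; rewrite sumE; have [C HC] := p_bounded b.
by have [] := cvg_sum_of_bounded HC.
Unshelve. all: by end_near. Qed.
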